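(* For every non-zero real number $[a]\in\mathcal{S}_{\mathbb{R}}\setminus\{[0]\}$ there exists a real number $[\xi]\in\mathcal{S}_{\mathbb{R}}$ such that $[a]*[\xi]=[1]$.
   Context: Conventions. $\omega=\{0,1,2,\dots\}$, $\omega_+=\omega\setminus\{0\}$, $[a,b]_\omega=\{n\in\omega:a\le n\le b\}$, $[a,\infty]_\omega=\{n\in\omega:n\ge a\}$; empty products equal $1$. A system function $\vartheta:\omega_+\to[2,\infty]_\omega$ is fixed. Contractions. For $f:\omega\to\omega$ and $n\in\omega_+$, the contraction $c_n$ is applicable to $f$ iff $f(n+1)\ge\vartheta(n)$, and then $c_n(f)(n)=f(n)+1$, $c_n(f)(n+1)=f(n+1)-\vartheta(n)$, $c_n(f)(k)=f(k)$ for other $k$. A sequence of contractions is a finite (possibly empty) composition of contractions; it is applicable to $f$ iff each contraction in turn is applicable to the result of the preceding ones. Sign. For $f:\omega\to\omega$, $\sigma(f)=0$ if $f(0)$ is odd and $\sigma(f)=1$ if $f(0)$ is even. Auxiliary functions. $h:\omega\to\omega$ is a primary auxiliary function ($h\in A_p$) if $h(k)<\vartheta(k-1)$ for all $k\ge2$ and for every $N\in\omega_+$ there is $M\ge N+1$ with $h(M)\ne\vartheta(M-1)-1$. It is a secondary auxiliary function ($h\in A_s$) if $h(k)<\vartheta(k-1)$ for all $k\ge2$ and there is $N\in\omega_+$ with $h(M)=\vartheta(M-1)-1$ for all $M\ge N+1$; the least such $N$ is $N^h_{\min}$. Base set. $W_1$ is the set of pairs $(h_p,h_s)\in A_p\times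 A_s$ such that, with $N=N^{h_s}_{\min}$, $h_p(k)=h_s(k)$ for $k<N$, $h_p(N)=h_s(N)+1$, and $h_p(k)=0$ for $k>N$. Two pairs in $W_1$ are equivalent if their first components agree on $\omega_+$ and have the same sign; $F$ is the collection of sets obtained by taking, for each equivalence class, the set of all functions that are components of its pairs. $W_2$ is the set of primary auxiliary functions occurring in no pair of $W_1$; two elements of $W_2$ are equivalent if they agree on $\omega_+$ and have the same sign; $G_2$ is the set of equivalence classes. The base set is $B=F\cup G_2$. Real numbers. For $b\in B$, $r_b$ is the set of $f:\omega\to\omega$ for which there is $h\in b$ such that for every $N\in\omega_+$ some sequence of contractions $\mathcal{C}$ applicable to $f$ satisfies $\mathcal{C}(f)(n)=h(n)$ for all $n\in[0,N]_\omega$. Let $b_1,b_2\in B$ be the elements containing respectively the zero function, and the function with value $1$ at $0$ and $0$ elsewhere. $\mathcal{S}_{\mathbb{R}}$ (the set of real numbers) consists of all $r_b$ with $b\in B\setminus\{b_1,b_2\}$ together with $[0]:=r_{b_1}\cup r_{b_2}$. Distinct real numbers are disjoint. A function lying in some real number is called finite, and $[f]$ denotes the real number containing $f$. $[1]:=[1_p]$, where $1_p:\omega\to\omega$ has $1_p(1)=1$ and $1_p(k)=0$ for $k\ne1$. Multiplication. For $a,b\in\omega$ let $\Upsilon(a,b)=\max\{a,b\}-\min\{a,b\}$. For $n,k,K\in\omega_+$ let $$R(n,k,K)=\max\Big\{t\in\omega:\ t\prod_{j=1}^{n-1}\vartheta(j)\prod_{j=1}^{k-1}\vartheta(j)\le\prod_{j=1}^{K-1}\vartheta(j)\Big\}.$$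 The rest function is $r(n,k,1)=R(n,k,1)$ and $r(n,k,M)=\Upsilon\big(R(n,k,M),\ \vartheta(M-1)R(n,k,M-1)\big)$ for $M\ge2$. For finite $f,g$ the sub-product $f*g:\omega\to\omega$ is $(f*g)(0)=f(0)+g(0)$ and $(f*g)(M)=\sum_{n=1}^M\sum_{k=1}^M f(n)g(k)\,r(n,k,M)$ for $M\in\omega_+$. Multiplication of real numbers: $[f]*[g]:=[f*g]$ for any $f\in[f]$, $g\in[g]$ (independent of the choice of representatives). *)

(* Defs.v *)
From mathcomp Require Import all_boot.
From mathcomp Require Import boolp classical_sets.

Set Implicit Arguments.
Unset Strict Implicit.
Unset Printing Implicit Defensive.

Local Open Scope classical_set_scope.

(* A system function is a map on the positive integers with values >= 2.  It is
   encoded as theta : nat -> nat; theta 0 is a junk value with no effect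
   on any of the notions below. *)
Definition system_function (theta : nat -> nat) : Prop :=
  forall n, 0 < n -> 2 <= theta n.

Section SystemFunction.
Variable theta : nat -> nat.
Implicit Types (f g h : nat -> nat) (b x y z : set (nat -> nat)).

Definition contraction_applicable (n : nat) f : Prop :=
  0 < n /\ theta n <= f n.+1.

Definition contraction (n : nat) f : nat -> nat := fun k =>
  if k == n then f n + 1
  else if k == n.+1 then f n.+1 - theta n
  else f k.

(* A sequence of contractions is the list of its indices, performed from left
   to right. *)
Fixpoint contract (C : seq nat) f : nat -> nat :=
  if C is n :: C' then contract C' (contraction n f) else f.

Fixpoint applicable (C : seq nat) f : Prop :=
  if C is n :: C' then
    contraction_applicable n f /\ applicable C' (contraction n f)
  else True.

Definition sigma f : nat := if odd (f 0) then 0 else 1.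

Definition primary : set (nat -> nat) := [set h |
  (forall k, 2 <= k -> h k < theta k.-1) /\
  (forall N, 0 < N -> exists M, N.+1 <= M /\ h M <> theta M.-1 - 1)].

Definition maximal_after h (N : nat) : Prop :=
  0 < N /\ forall M, N.+1 <= M -> h M = theta M.-1 - 1.

Definition secondary : set (nat -> nat) := [set h |
  (forall k, 2 <= k -> h k < theta k.-1) /\ exists N, maximal_after h N].

Definition is_Nmin h (N : nat) : Prop :=
  maximal_after h N /\ forall N', maximal_after h N' -> N <= N'.

Definition W1 : set ((nat -> nat) * (nat -> nat)) := [set p |
  [/\ primary p.1, secondary p.2 &
    exists N, [/\ is_Nmin p.2 N,
      forall k, k < N -> p.1 k = p.2 k,
      p.1 N = p.2 N + 1 &
      forall k, N < k -> p.1 k = 0]]].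

Definition aux_equiv f g : Prop :=
  (forall k, 0 < k -> f k = g k) /\ sigma f = sigma g.

Definition F : set (set (nat -> nat)) := [set b |
  exists2 p, W1 p &
    b = [set h | exists q, [/\ W1 q, aux_equiv q.1 p.1 & h = q.1 \/ h = q.2]]].

Definition W2 : set (nat -> nat) := [set h |
  primary h /\ ~ exists q, W1 q /\ (h = q.1 \/ h = q.2)].

Definition G2 : set (set (nat -> nat)) := [set b |
  exists2 h0, W2 h0 & b = [set h | W2 h /\ aux_equiv h h0]].

Definition base_set : set (set (nat -> nat)) := F `|` G2.

Definition r_ b : set (nat -> nat) := [set f |
  exists2 h, b h &
    forall N, 0 < N -> exists2 C : seq nat, applicable C f &
      forall n, n <= N -> contract C f n = h n].

(* xget set0 P plays the role of "the set satisfying P"; set0 is only a default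
   for the case where there is none. *)
Definition b1 : set (nat -> nat) :=
  xget set0 [set b | base_set b /\ b (fun _ => 0)].

Definition b2 : set (nat -> nat) :=
  xget set0 [set b | base_set b /\ b (fun k => if k == 0 then 1 else 0)].

Definition zeroR : set (nat -> nat) := r_ b1 `|` r_ b2.

Definition SR : set (set (nat -> nat)) := [set x |
  (exists b, [/\ base_set b, b <> b1, b <> b2 & x = r_ b]) \/ x = zeroR].

(* [f]; it is set0, which is not a real number, when f is not finite. *)
Definition real_of f : set (nat -> nat) := xget set0 [set x | SR x /\ x f].

Definition one_p : nat -> nat := fun k => if k == 1 then 1 else 0.

Definition oneR : set (nat -> nat) := real_of one_p.

Definition Upsilon (m n : nat) : nat := maxn m n - minn m n.

Definition place (n : nat) : nat := \prod_(1 <= j < n) theta j.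

(* The bound on t loses no candidate: place n * place k is positive for a
   system function, so every admissible t is at most place K. *)
Definition R (n k K : nat) : nat :=
  \max_(t < (place K).+1 | t * (place n * place k) <= place K) t.

(* Only used for M >= 1. *)
Definition rest (n k M : nat) : nat :=
  if M is M'.+2 then Upsilon (R n k M) (theta M.-1 * R n k M.-1)
  else R n k 1.

Definition subproduct f g : nat -> nat := fun M =>
  if M == 0 then f 0 + g 0
  else \sum_(1 <= n < M.+1) \sum_(1 <= k < M.+1) f n * g k * rest n k M.

(* The product is the real number that equals [f * g] for every choice of
   representatives f in x and g in y; independence of the representatives is
   thus part of the product being defined. *)
Definition mulR x y : set (nat -> nat) :=
  xget set0 [set z | SR z /\
    forall f g, x f -> y g -> real_of (subproduct f g) = z].

End SystemFunction.

(* Main.v *)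
(* Let v f be the sum of f k / place k over k >= 1.  Contractions preserve v and
   f 0, and every f of finite value reduces to the expansion whose first digits
   are those of the (eventually constant) floors of place n times the partial
   sums of f.  A primary function is the greedy expansion of its value, and a
   pair in W1 consists of the two expansions of one number.  Hence the non-zero
   real numbers are exactly the sets {f | v f = V, sigma f = s} with V > 0, and
   [0] is {f | v f = 0}.  Since R n k M is the floor of
   place M / (place n * place k), the rest function lists the greedy digits of
   1 / (place n * place k), so that v (f * g) = v f * v g.  The inverse of the
   class of value V is therefore the class of value 1 / V with the same sign. *)

Require Import Defs.
From mathcomp Require Import all_boot all_order all_algebra.
From mathcomp Require Import boolp classical_sets reals Rstruct.
From mathcomp Require Import ring zify.

Set Implicit Arguments.
Unset Strict Implicit.
Unset Printing Implicit Defensive.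

Import Order.TTheory GRing.Theory Num.Theory.

Section RadixExpansions.
Variables (K : realType) (theta : nat -> nat).
Hypothesis theta_ge2 : system_function theta.
Implicit Types (f g h : nat -> nat) (b : set (nat -> nat)) (C : seq nat).

(** * Place values, the rest function and digits *)

Lemma theta_gt0 n : 0 < n -> 0 < theta n.
Proof. by move=> /theta_ge2; apply: leq_trans. Qed.

Lemma place1 : place theta 1 = 1.
Proof. by rewrite /place big_geq. Qed.

Lemma placeS n : 0 < n -> place theta n.+1 = place theta n * theta n.
Proof. by move=> n0; rewrite /place big_nat_recr. Qed.

Lemma place_gt0 n : 0 < place theta n.
Proof.
elim: n => [|[|n] IHn]; [by rewrite /place big_geq | by rewrite place1 |].
by rewrite placeS // muln_gt0 IHn theta_gt0.
Qed.

Lemma leq_place m n : m <= n -> place theta m <= place theta n.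
Proof.
elim: n => [|n IHn]; first by rewrite leqn0 => /eqP->.
rewrite leq_eqVlt => /orP[/eqP->//|/IHn le_mn]; apply: (leq_trans le_mn).
case: n {IHn le_mn} => [|n]; first by rewrite place1 /place big_geq.
by rewrite (placeS (ltn0Sn n)) leq_pmulr ?theta_gt0.
Qed.

Lemma ltn_place n : n < place theta n.+1.
Proof.
elim: n => [|n IHn]; first by rewrite place1.
by rewrite placeS //; have := theta_ge2 (ltn0Sn n); nia.
Qed.

Lemma R_divn n k N :
  R theta n k N = place theta N %/ (place theta n * place theta k).
Proof.
have p0 : 0 < place theta n * place theta k by rewrite muln_gt0 !place_gt0.
apply/eqP; rewrite eqn_leq; apply/andP; split.
  by apply/bigmax_leqP => t; rewrite -leq_divRL.
set q := _ %/ _; have ltq : q < (place theta N).+1 by rewrite ltnS leq_div.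
by apply: (bigop.bigmax_sup (Ordinal ltq)); rewrite //= leq_divM.
Qed.

(** For these indices [place n * place k] exceeds [place N]. This allows the double sum at level [N]
    to be extended to the index range of level [N + 1]. *)
Lemma R_eq0 n k N : 0 < N -> (N < n) || (N < k) -> R theta n k N = 0.
Proof.
move=> N0 ltN; rewrite R_divn divn_small //.
have := place_gt0 n; have := place_gt0 k.
have lt_place m : N < m -> place theta N < place theta m.
  move=> /leq_place; apply: leq_trans; rewrite placeS //.
  by rewrite ltn_Pmulr ?place_gt0 ?theta_ge2.
by case/orP: ltN => /lt_place; nia.
Qed.

(** Multiplying a floor by [theta N] cannot exceed the floor of the multiplied quotient, so
    [Upsilon] is here a genuine difference and [rest] is the digit that passes from one level to the
    next. *)
Lemma restS n k N : 0 < N ->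
  theta N * R theta n k N + rest theta n k N.+1 = R theta n k N.+1.
Proof.
case: N => // N _; rewrite /rest /Upsilon /=.
set b := theta _ * _; set a := R _ _ _ N.+2.
have le_ba : b <= a.
  rewrite /a /b !R_divn leq_divRL ?muln_gt0 ?place_gt0 // (placeS (ltn0Sn _)).
  rewrite -mulnA [X in _ <= X]mulnC leq_mul2l; apply/orP; right.
  exact: leq_divM.
by rewrite (maxn_idPl le_ba) (minn_idPr le_ba) subnKC.
Qed.

(* The digits read off from D n = floor (place n * x), with c as sign entry. *)
Definition digits (c : nat) (D : nat -> nat) : nat -> nat := fun k =>
  match k with
  | 0 => c
  | 1 => D 1
  | (j.+1 as i).+1 => D i.+1 - theta i * D i
  end.

Lemma eq_digits c D D' k :
  (forall i, 0 < i <= k -> D i = D' i) -> digits c D k = digits c D' k.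
Proof.
case: k => [|[|k]] eqD //=; first by rewrite eqD.
by rewrite !eqD ?leqnn ?leqnSn.
Qed.

(** Horner's scheme for [place n] times the n-th partial value, kept in [nat]; at [n = 1] the
    default entry [theta 0] meets the factor 0. *)
Fixpoint scaled_sum f (n : nat) : nat :=
  if n is m.+1 then theta m * scaled_sum f m + f n else 0.

Lemma digits_scaled_sum f k : digits (f 0) (scaled_sum f) k = f k.
Proof.
case: k => [|[|k]] //; first by rewrite /= muln0.
exact: addKn.
Qed.

Lemma scaled_sum_digits c D n : 0 < n ->
  (forall i, 0 < i -> theta i * D i <= D i.+1) ->
  scaled_sum (digits c D) n = D n.
Proof.
move=> + leD; elim: n => // -[|n] IHn _; first by rewrite /= muln0.
have -> : scaled_sum (digits c D) n.+2 =
  theta n.+1 * scaled_sum (digits c D) n.+1 +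
  (D n.+2 - theta n.+1 * D n.+1) by [].
by rewrite IHn // subnKC ?leD.
Qed.

(** * Sequences of contractions *)

Lemma contract_cat C C' f :
  contract theta (C ++ C') f = contract theta C' (contract theta C f).
Proof. by elim: C f => //= n C IHC f. Qed.

Lemma applicable_cat C C' f : applicable theta C f ->
  applicable theta C' (contract theta C f) -> applicable theta (C ++ C') f.
Proof. by elim: C f => //= n C IHC f [appn appC] /(IHC _ appC). Qed.

Lemma contract0 C f : applicable theta C f -> contract theta C f 0 = f 0.
Proof. by elim: C f => //= n C IHC f [[n0 _] /IHC ->]; case: n n0. Qed.

(** Each use of [c_n] takes [theta n] off the entry at [n + 1], so repeating it leaves the
    remainder. *)
Lemma contract_modulo n f : 0 < n -> exists C,
  [/\ applicable theta C f, all (eq_op^~ n) C &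
    contract theta C f n.+1 < theta n].
Proof.
move=> n0; elim/ltn_ind: {f}(f n.+1) {-2}f (erefl (f n.+1)) => m IHm f fn.
case: (ltnP m (theta n)) => [lt_m|le_m]; first by exists [::]; rewrite /= fn.
have cn : contraction theta n f n.+1 = m - theta n.
  by rewrite /contraction -fn eqn_leq ltnn eqxx.
have [|C [appC allC ltC]] := IHm (m - theta n) _ _ cn.
  by have := theta_gt0 n0; lia.
exists (n :: C); split=> //=; rewrite ?eqxx //.
by split=> //; split=> //; rewrite fn.
Qed.

Lemma contract_out n C f k : all (fun i => i < n) C -> n < k ->
  contract theta C f k = f k.
Proof.
move=> + lt_nk; elim: C f => //= i C IHC f /andP[lt_in /IHC ->].
by rewrite /contraction !ifN //; apply/eqP; lia.
Qed.

Lemma contract_normalize n f : exists C,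
  [/\ applicable theta C f, all (fun i => i < n) C &
    forall k, 2 <= k <= n -> contract theta C f k < theta k.-1].
Proof.
elim: n f => [|n IHn] f; first by exists [::]; split=> // k; lia.
case: n IHn => [|n] IHn; first by exists [::]; split=> // k; lia.
have [C [appC allC ltC]] := contract_modulo f (ltn0Sn n).
have [C' [appC' allC' ltC']] := IHn (contract theta C f).
exists (C ++ C'); split; first exact: applicable_cat.
  rewrite all_cat; apply/andP; split.
    by apply: sub_all allC => i /eqP->.
  by apply: sub_all allC' => i /ltnW.
move=> k /andP[k2]; rewrite leq_eqVlt contract_cat => /orP[/eqP->|lt_kn].
  by rewrite (contract_out _ allC').
by apply: ltC'; rewrite k2.
Qed.

Local Open Scope ring_scope.

(** * Partial values and the value of a function *)

Definition partial_value f n : K :=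
  \sum_(1 <= k < n.+1) (f k)%:R / (place theta k)%:R.

(** The supremum of the partial values, as a relation, so that a function with unbounded partial
    values has no value. *)
Definition is_value f (V : K) : Prop :=
  (forall n, partial_value f n <= V) /\
  (forall W, (forall n, partial_value f n <= W) -> V <= W).

Lemma natr_place_gt0 n : 0 < (place theta n)%:R :> K.
Proof. by rewrite ltr0n place_gt0. Qed.

Lemma natr_place_neq0 n : (place theta n)%:R != 0 :> K.
Proof. by rewrite gt_eqF ?natr_place_gt0. Qed.

Lemma natr_placeS n : (0 < n)%N ->
  (place theta n.+1)%:R = (place theta n)%:R * (theta n)%:R :> K.
Proof. by move=> n0; rewrite placeS // natrM. Qed.

Lemma partial_value0 f : partial_value f 0 = 0.
Proof. by rewrite /partial_value big_geq. Qed.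

Lemma partial_valueS f n : partial_value f n.+1 =
  partial_value f n + (f n.+1)%:R / (place theta n.+1)%:R.
Proof. by rewrite /partial_value big_nat_recr. Qed.

Lemma le_partial_value f m n : (m <= n)%N ->
  partial_value f m <= partial_value f n.
Proof.
move=> /subnK <-; elim: (n - m)%N => // {}n /le_trans; apply.
by rewrite addSn partial_valueS lerDl divr_ge0.
Qed.

Lemma partial_value_ge0 f n : 0 <= partial_value f n.
Proof. by rewrite -(partial_value0 f) le_partial_value. Qed.

Lemma eq_partial_value f g n : (forall k, (0 < k <= n)%N -> f k = g k) ->
  partial_value f n = partial_value g n.
Proof. by move=> fg; apply: eq_big_nat => k kn; rewrite fg. Qed.

Lemma natr_scaled_sum f n : (0 < n)%N ->
  (scaled_sum f n)%:R = (place theta n)%:R * partial_value f n.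
Proof.
elim: n => // -[|n] IHn _.
  rewrite /= muln0 partial_valueS partial_value0 place1.
  by rewrite divr1 mul1r add0r.
rewrite [scaled_sum _ _]/(_ * scaled_sum _ n.+1 + _)%N natrD natrM IHn //.
rewrite (partial_valueS f n.+1) (natr_placeS (ltn0Sn n)).
by field; rewrite natr_place_neq0 gt_eqF // ltr0n theta_gt0.
Qed.

(** [c_n] trades [theta n] units of size [1 / place (n + 1)] for one unit of size [1 / place n].
    Only the partial sum cut between these two positions sees the trade. *)
Lemma partial_value_contraction n f m : contraction_applicable theta n f ->
  partial_value (contraction theta n f) m =
  partial_value f m + (if m == n then ((place theta n)%:R)^-1 else 0).
Proof.
move=> [n0 le_f]; elim: m => [|m IHm].
  by rewrite !partial_value0; case: eqP n0 => [<-|_]; rewrite // addr0.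
rewrite !partial_valueS IHm /contraction eqSS.
have [->|neq_mn] := eqVneq m n.
  rewrite (gtn_eqF (ltnSn n)) natrB // (natr_placeS n0).
  by field; rewrite natr_place_neq0 gt_eqF // ltr0n theta_gt0.
have [->|_] := eqVneq m.+1 n; rewrite ?natrD; field; exact: natr_place_neq0.
Qed.

Lemma le_partial_value_contract C f n : applicable theta C f ->
  partial_value f n <= partial_value (contract theta C f) n.
Proof.
elim: C f => //= i C IHC f [appi /IHC]; apply: le_trans.
by rewrite partial_value_contraction // lerDl; case: ifP; rewrite ?invr_ge0.
Qed.

Lemma partial_value_contract_le C f n : applicable theta C f ->
  exists m, partial_value (contract theta C f) n <= partial_value f m.
Proof.
elim: C f => [|i C IHC] f /=; first by exists n.
(* A cut at [i + 1] or later includes both positions touched by [c_i], so the partial value is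
   unchanged there. *)
move=> [appi /IHC[m le_m]]; exists (maxn m i.+1); apply: (le_trans le_m).
have -> : partial_value f (maxn m i.+1) =
    partial_value (contraction theta i f) (maxn m i.+1).
  by rewrite partial_value_contraction // ifN ?addr0 //; apply/eqP; lia.
by rewrite le_partial_value ?leq_maxl.
Qed.

Lemma partial_value_contract n C f :
  applicable theta C f -> all (fun i => i < n)%N C ->
  partial_value (contract theta C f) n = partial_value f n.
Proof.
elim: C f => //= i C IHC f [appi appC] /andP[lt_in allC]; rewrite IHC //.
by rewrite partial_value_contraction // ifN ?addr0 // gtn_eqF.
Qed.

Lemma is_value_uniq f V W : is_value f V -> is_value f W -> V = W.
Proof. by move=> [ub leV] [ub' leW]; apply/le_anti; rewrite leV ?leW. Qed.

Lemma is_value_ge0 f V : is_value f V -> 0 <= V.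
Proof. by move=> [/(_ 0%N)]; rewrite partial_value0. Qed.

Lemma is_value_exists f W : (forall n, partial_value f n <= W) ->
  exists V, is_value f V.
Proof.
move=> leW; exists (sup (range (partial_value f))).
have nonempty : (range (partial_value f) !=set0)%classic.
  by exists (partial_value f 0); exists 0%N.
split=> [n|X leX]; last by apply: ge_sup => // _ [n _ <-].
apply: sup_upper_bound; last by exists n.
by split=> //; exists W => _ [m _ <-].
Qed.

Lemma is_value_cofinal f g V :
  (forall n, exists m, partial_value f n <= partial_value g m) ->
  (forall n, exists m, partial_value g n <= partial_value f m) ->
  is_value f V -> is_value g V.
Proof.
move=> fg gf [ub leV]; split=> [n|W leW].
  by have [m /le_trans ->] := gf n.
by apply: leV => n; have [m /le_trans ->] := fg n.
Qed.

Lemma eq_is_value f g V : (forall k, (0 < k)%N -> f k = g k) ->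
  is_value f V -> is_value g V.
Proof.
move=> fg; have pv n : partial_value f n = partial_value g n.
  by apply: eq_partial_value => k /andP[/fg].
by apply: is_value_cofinal => n; exists n; rewrite pv.
Qed.

(** * Greedy digits and floors *)

(** The extreme digit [theta k - 1] at position [k + 1] contributes
    [1 / place k - 1 / place (k + 1)], and these bounds telescope. *)
Lemma le_partial_value_digits f m n : (0 < n <= m)%N ->
  (forall k, (1 < k <= m)%N -> (f k < theta k.-1)%N) ->
  partial_value f m <= partial_value f n +
    ((place theta n)%:R)^-1 - ((place theta m)%:R)^-1.
Proof.
move=> /andP[n0]; elim: m => [|m IHm]; first by case: n n0.
rewrite leq_eqVlt ltnS => /orP[/eqP<- _|le_nm ltf]; first by rewrite addrK.
have m0 : (0 < m)%N by apply: leq_trans le_nm.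
rewrite partial_valueS (natr_placeS m0).
have IH : partial_value f m <= partial_value f n +
    ((place theta n)%:R)^-1 - ((place theta m)%:R)^-1.
  by apply: IHm => // k /andP[k1 km]; apply: ltf; rewrite k1 ltnW.
rewrite -lerBrDr; apply: (le_trans IH).
rewrite -!addrA !lerD2l -subr_ge0.
have -> : - ((place theta m)%:R * (theta m)%:R)^-1 -
     (f m.+1)%:R / ((place theta m)%:R * (theta m)%:R) -
     - ((place theta m)%:R)^-1 =
    ((theta m)%:R - (f m.+1).+1%:R) / ((place theta m)%:R * (theta m)%:R) :> K.
  by rewrite -natr1; field; rewrite natr_place_neq0 gt_eqF // ltr0n theta_gt0.
by rewrite divr_ge0 ?mulr_ge0 // subr_ge0 ler_nat ltf // ltnS m0 leqnn.
Qed.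

Lemma truncn_scaled_sum f n V : (0 < n)%N ->
  partial_value f n <= V < partial_value f n + ((place theta n)%:R)^-1 ->
  Num.truncn ((place theta n)%:R * V) = scaled_sum f n.
Proof.
move=> n0 /andP[leV ltV]; apply: truncn_def; rewrite -natr1 natr_scaled_sum //.
have pn := natr_place_gt0 n; rewrite ler_pM2l // leV /=.
rewrite -(ltr_pM2l pn) in ltV; apply: (lt_le_trans ltV).
by rewrite mulrDr divff ?natr_place_neq0.
Qed.

(** In a finite prefix the part after [i] stays below [1 / place i] by at least [1 / place n], so
    the prefix is the greedy expansion of its own partial value. *)
Lemma bounded_digits_truncn f n :
  (forall k, (1 < k <= n)%N -> (f k < theta k.-1)%N) ->
  forall k, (k <= n)%N -> f k =
    digits (f 0%N)
      (fun i => Num.truncn ((place theta i)%:R * partial_value f n)) k.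
Proof.
move=> ltf k le_kn; rewrite -[LHS]digits_scaled_sum; apply: eq_digits => i.
move=> /andP[i0 le_ik]; have le_in := leq_trans le_ik le_kn.
apply/esym/truncn_scaled_sum; rewrite // le_partial_value //=.
have i_range : (0 < i <= n)%N by rewrite i0.
apply: le_lt_trans (le_partial_value_digits i_range ltf) _.
by rewrite ltrBlDr ltrDl invr_gt0 natr_place_gt0.
Qed.

(* A digit h M <> theta (M-1) - 1 beyond n makes the tail of h after n strictly
   smaller than 1 / place n, so that the n-th partial value is a true floor. *)
Lemma primary_truncn h V : primary theta h -> is_value h V -> forall k, h k =
  digits (h 0%N) (fun i => Num.truncn ((place theta i)%:R * V)) k.
Proof.
move=> [lth nmax] [ubV leV] k; rewrite -[LHS]digits_scaled_sum.
apply: eq_digits => n /andP[n0 _].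
apply/esym/truncn_scaled_sum; rewrite // ubV /=.
have ltf m : forall i, (1 < i <= m)%N -> (h i < theta i.-1)%N.
  by move=> i /andP[/lth].
have [[|M] [// lt_nM /eqP hM]] := nmax _ n0; rewrite ltnS /= in lt_nM hM.
have M0 : (0 < M)%N by apply: leq_trans lt_nM.
have pM := natr_place_gt0 M.+1.
(* The margin is one unit at position [M + 1]: the digit there is at most [theta M - 2], and
   everything after it adds at most one more such unit. *)
apply: (@le_lt_trans _ _ (partial_value h n + ((place theta n)%:R)^-1
          - ((place theta M.+1)%:R)^-1)); last first.
  by rewrite ltrBlDr ltrDl invr_gt0.
apply: leV => m; apply: (le_trans (le_partial_value _ (leq_maxl m M.+1))).
have le_max : (0 < M.+1 <= maxn m M.+1)%N by rewrite leq_maxr.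
have le_nM : (0 < n <= M)%N by rewrite n0.
apply: le_trans (le_partial_value_digits le_max (ltf _)) _.
apply: (@le_trans _ _ (partial_value h M.+1 + ((place theta M.+1)%:R)^-1)).
  by rewrite lerBlDr lerDl invr_ge0.
rewrite partial_valueS -addrA -lerBrDr.
apply: le_trans (le_partial_value_digits le_nM (ltf _)) _.
rewrite -!addrA !lerD2l -subr_ge0.
have : (h M.+1 <= theta M - 2)%N by have := lth _ (M0 : 1 < M.+1)%N => /=; lia.
rewrite -(ler_nat K) natrB ?theta_ge2 // => le_h.
have -> : - ((place theta M.+1)%:R)^-1 -
    ((h M.+1)%:R / (place theta M.+1)%:R + ((place theta M.+1)%:R)^-1) -
    - ((place theta M)%:R)^-1 =
    ((theta M)%:R - 2 - (h M.+1)%:R) / (place theta M.+1)%:R :> K.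
  rewrite natr_placeS //.
  by field; rewrite natr_place_neq0 gt_eqF // ltr0n theta_gt0.
by rewrite divr_ge0 // subr_ge0.
Qed.
(** Since [place (n + 1) > n], an error of a fixed number [c] of units [1 / place n] tends to 0;
    this is the Archimedean step behind all the limits below. *)
Lemma le_place_limit (x y c : K) m :
  (forall n, (m <= n)%N -> x <= y + c / (place theta n)%:R) -> x <= y.
Proof.
move=> lexy; rewrite leNgt; apply/negP => lt_yx.
have := archi_boundP (normr_ge0 (c / (x - y))).
set B := Num.bound _ => lt_B; have := lexy _ (leq_maxl m B.+1).
have pn := natr_place_gt0 (maxn m B.+1).
rewrite -lerBlDl ler_pdivlMr // mulrC -ler_pdivlMr ?subr_gt0 //.
rewrite leNgt => /negP; apply; apply: (le_lt_trans (ler_norm _)).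
apply: (lt_le_trans lt_B); rewrite ler_nat ltnW //.
by apply: leq_trans (ltn_place B) _; rewrite leq_place ?leq_maxr.
Qed.

(** The lower bound makes the subtraction in [digits] genuine; the upper bound keeps the resulting
    digit below [theta n]. *)
Lemma theta_truncn n (x : K) : (0 < n)%N -> 0 <= x ->
  (theta n * Num.truncn ((place theta n)%:R * x)
     <= Num.truncn ((place theta n.+1)%:R * x)
     < theta n * Num.truncn ((place theta n)%:R * x) + theta n)%N.
Proof.
move=> n0 x0; rewrite natr_placeS // mulrAC.
set y := _ * x; have y0 : 0 <= y by rewrite mulr_ge0.
have t0 : 0 < (theta n)%:R :> K by rewrite ltr0n theta_gt0.
rewrite truncn_ge_nat ?mulr_ge0 // natrM mulrC ler_pM2r // truncn_le y0 /=.
rewrite -(ltr_nat K); apply: (@le_lt_trans _ _ (y * (theta n)%:R)).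
  by rewrite truncn_le mulr_ge0.
by rewrite -mulnSr mulnC natrM ltr_pM2r // truncnS_gt.
Qed.

(** The n-th partial value is a floor divided by [place n], hence falls short of [V] by less than
    [1 / place n]. *)
Lemma is_value_digits c (V : K) : 0 <= V ->
  is_value (digits c (fun n => Num.truncn ((place theta n)%:R * V))) V.
Proof.
move=> V0; set h := digits _ _.
have hE n : (0 < n)%N -> (place theta n)%:R * partial_value h n =
    (Num.truncn ((place theta n)%:R * V))%:R.
  move=> n0; rewrite -natr_scaled_sum // scaled_sum_digits //.
  by move=> i i0; have /andP[] := theta_truncn i0 V0.
split=> [n|W leW].
  case: (posnP n) => [->|n0]; first by rewrite partial_value0.
  by rewrite -(ler_pM2l (natr_place_gt0 n)) hE // truncn_le mulr_ge0.
apply: (@le_place_limit _ _ 1 1) => n n0.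
apply: (@le_trans _ _ (partial_value h n + 1 / (place theta n)%:R)).
  rewrite -(ler_pM2l (natr_place_gt0 n)) mulrDr hE // mulrCA.
  by rewrite divff ?natr_place_neq0 // mulr1 natr1 ltW // truncnS_gt.
by rewrite lerD2r.
Qed.

Lemma bounded_nondecreasing_stable (u : nat -> nat) B :
  {homo u : m n / (m <= n)%N} -> (forall n, u n <= B)%N ->
  exists d m, forall n, (m <= n)%N -> u n = d.
Proof.
move=> homo_u leB; pose P d := `[< exists n, u n = d >].
have exP : exists d, P d by exists (u 0%N); apply/asboolP; exists 0%N.
have ubP d : P d -> (d <= B)%N by move=> /asboolP[n <-].
case: (ex_maxnP exP ubP) => d /asboolP[m um] max_d; exists d, m => n le_mn.
by apply/eqP; rewrite eqn_leq max_d -?um ?homo_u //; apply/asboolP; exists n.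
Qed.

(** * Reduction of a function to an expansion *)

(** The condition that [r_] imposes on a member [f] and a chosen [h]. *)
Definition reduces_to f h : Prop := forall N, (0 < N)%N ->
  exists2 C, applicable theta C f &
    forall n, (n <= N)%N -> contract theta C f n = h n.

Lemma reduces_to_value f h V : reduces_to f h -> is_value h V -> is_value f V.
Proof.
move=> red; have contr n : exists2 C, applicable theta C f &
    partial_value (contract theta C f) n = partial_value h n.
  have [C appC Ch] := red _ (ltn0Sn n); exists C => //.
  by apply: eq_partial_value => k /andP[_ le_kn]; rewrite Ch // ltnW.
apply: is_value_cofinal => n; have [C appC Ch] := contr n.
  by rewrite -Ch; apply: partial_value_contract_le.
by exists n; rewrite -Ch; apply: le_partial_value_contract.
Qed.

Lemma reduces_to0 f h : reduces_to f h -> f 0%N = h 0%N.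
Proof.
by move=> /(_ 1%N isT) [C appC /(_ 0%N isT) <-]; rewrite (contract0 appC).
Qed.

(** For each [k] the floors of [place k] times the partial values increase and are bounded, so they
    stabilise, and [h] is read off from the limits [D]. If the partial values approach [V] strictly
    from below, [D k] can be smaller than the floor of [place k * V]; secondary expansions arise in
    this way. *)
Lemma finite_expansion f V : is_value f V -> exists2 h, reduces_to f h &
  forall k, (1 < k)%N -> (h k < theta k.-1)%N.
Proof.
move=> valf; have [ubV _] := valf; have V0 := is_value_ge0 valf.
pose u k n := Num.truncn ((place theta k)%:R * partial_value f n).
have /choice[D /choice[m0 stab]] k :
    exists d m, forall n, (m <= n)%N -> u k n = d.
  apply: (@bounded_nondecreasing_stable _ (Num.truncn ((place theta k)%:R * V))).
    move=> m n le_mn; apply: le_truncn.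
    by rewrite ler_wpM2l // le_partial_value.
  by move=> n; apply: le_truncn; rewrite ler_wpM2l.
exists (digits (f 0%N) D) => [N N0|[|[|k]] // _]; last first.
  pose n := maxn (m0 k.+2) (m0 k.+1); rewrite /=.
  rewrite -(stab k.+2 n) ?leq_maxl // -(stab k.+1 n) ?leq_maxr //.
  have /andP[le_u] := theta_truncn (ltn0Sn k) (partial_value_ge0 f n).
  by rewrite ltn_subLR.
(* This [n] is past every stabilisation index for [k <= N], and at least [N], so normalising up to
   [n] fixes all the required digits. *)
pose n := maxn N (\max_(k < N.+1) m0 k).
have [C [appC allC ltC]] := contract_normalize n f.
exists C => // k le_kN; rewrite (bounded_digits_truncn ltC) ?leq_max ?le_kN //.
rewrite (contract0 appC) (partial_value_contract appC allC); apply: eq_digits.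
move=> i /andP[_ le_ik]; rewrite -/(u i n) stab // leq_max; apply/orP; right.
have lt_iN : (i < N.+1)%N by rewrite ltnS (leq_trans le_ik).
exact: (leq_bigmax_cond (F := fun k : 'I__ => m0 k) (Ordinal lt_iN)).
Qed.

(** * Expansions with bounded digits, pairs in [W1] and the base set *)

Lemma digits_value_exists h : (forall k, (1 < k)%N -> (h k < theta k.-1)%N) ->
  exists V, is_value h V.
Proof.
move=> lth; apply: (@is_value_exists _ (partial_value h 1 + 1)) => n.
apply: (le_trans (le_partial_value _ (leq_maxr 1 n))).
have rng : (0 < 1 <= maxn 1 n)%N by rewrite leq_maxl.
have lt_h k : (1 < k <= maxn 1 n)%N -> (h k < theta k.-1)%N.
  by move=> /andP[/lth].
apply: le_trans (le_partial_value_digits rng lt_h) _.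
by rewrite place1 invr1 lerBlDr lerDl invr_ge0.
Qed.

(* From the index N on, the partial values of q.2 and q.1 differ by 1 / place n:
   the two expansions of a number with a terminating expansion. *)
Lemma W1_value q V : W1 theta q -> is_value q.1 V -> is_value q.2 V.
Proof.
case: q => p s [_ _ [N [[[N0 /= max_s] _] /= eq_lt eqN eq_gt]]] /= [ubV leV].
have sE m : (N <= m)%N -> partial_value s m =
    partial_value p m - ((place theta m)%:R)^-1.
  elim: m => [|m IHm]; first by case: N N0 {eq_lt eqN eq_gt max_s}.
  rewrite leq_eqVlt => /orP[/eqP eN|]; rewrite !partial_valueS.
    have -> : partial_value s m = partial_value p m.
      by apply: eq_partial_value => k /andP[_ km]; rewrite eq_lt // eN.
    by rewrite -eN eqN natrD; field; apply: natr_place_neq0.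
  rewrite ltnS => le_Nm; have m0 : (0 < m)%N by apply: leq_trans le_Nm.
  rewrite IHm // eq_gt // max_s //= natrB ?theta_gt0 // natr_placeS //.
  by field; rewrite natr_place_neq0 gt_eqF // ltr0n theta_gt0.
have le_sp n : partial_value s n <= partial_value p (maxn n N).
  apply: (le_trans (le_partial_value _ (leq_maxl n N))).
  by rewrite sE ?leq_maxr // lerBlDr lerDl invr_ge0.
split=> [n|W leW]; first exact: le_trans (le_sp n) (ubV _).
apply: leV => n; apply: (@le_place_limit _ _ 1 (maxn n N)) => m.
rewrite geq_max => /andP[le_nm le_Nm]; rewrite div1r -lerBlDr.
by apply: le_trans (leW m); rewrite sE // lerD2r le_partial_value.
Qed.

Lemma W1_value_iff q V : W1 theta q -> is_value q.1 V <-> is_value q.2 V.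
Proof.
move=> Wq; split; first exact: W1_value.
have [[lt1 _] _ _] := Wq; have [V' val1] := digits_value_exists lt1.
by move=> /(is_value_uniq (W1_value Wq val1)) <-.
Qed.

Lemma W1_sigma q : W1 theta q -> sigma q.2 = sigma q.1.
Proof. by move=> [_ _ [N [[[N0 _] _] eq_lt _ _]]]; rewrite /sigma eq_lt. Qed.

Lemma primary_or_secondary h : (forall k, (1 < k)%N -> (h k < theta k.-1)%N) ->
  primary theta h \/ secondary theta h.
Proof.
move=> lth; have [ex_max|no_max] := pselect (exists N, maximal_after theta h N).
  by right.
left; split=> // N N0; apply: contrapT => nM.
apply: no_max; exists N; split=> // M le_M.
by apply: contrapT => hM; apply: nM; exists M.
Qed.

(** The primary partner is obtained by carrying: the tail of maximal digits after the least [N]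
    becomes 0 and the digit at [N] grows by one. *)
Lemma secondary_W1 h : secondary theta h -> exists2 q, W1 theta q & q.2 = h.
Proof.
move=> [lth [N0 max0]]; pose P N := `[< maximal_after theta h N >].
have exP : exists N, P N by exists N0; apply/asboolP.
case: (ex_minnP exP) => N /asboolP[N_gt0 maxN] minN {N0 max0 exP}.
pose p k := if (k < N)%N then h k else if k == N then (h N + 1)%N else 0%N.
have p_lt k : (1 < k)%N -> (p k < theta k.-1)%N.
  move=> k1; rewrite /p; case: (ltngtP k N) => [_|_|eqk]; first exact: lth.
    by apply: theta_gt0 => //; case: k k1 => [|[]].
  move: (k1) => /lth; rewrite addn1 leq_eqVlt -eqk => /orP[/eqP hk|//].
  (* If the carry overflowed, the digit at [k = N > 1] would itself be maximal, and the maximal tail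
     would already start from [N - 1]. *)
  have : P k.-1; last by move=> /minN; lia.
  apply/asboolP; split=> [|M le_M]; first by lia.
  have [->|neM] := eqVneq M k; first by rewrite -hk subn1.
  by apply: maxN; lia.
exists (p, h) => //; split=> /=.
(* Beyond [N] the digit 0 differs from [theta - 1], because [theta] is at least 2. *)
- split=> // n n0; exists (maxn N n).+1; split; first by rewrite ltnS leq_maxr.
  rewrite /p ifN ?ifN; [|by apply/eqP; lia|by rewrite -leqNgt leqW ?leq_maxl].
  by have := theta_ge2 (leq_trans n0 (leq_maxr N n)) => /=; lia.
- by split=> //; exists N.
exists N; split=> [|k lt_kN||k lt_Nk]; rewrite /p ?lt_kN ?ltnn ?eqxx //.
  by split=> // N' maxN'; apply: minN; apply/asboolP.
by rewrite ifN ?ifN //; [apply/eqP; lia | rewrite -leqNgt ltnW].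
Qed.

Lemma aux_equiv_sym f g : aux_equiv f g -> aux_equiv g f.
Proof. by move=> [fg sfg]; split=> // k /fg. Qed.

Lemma aux_equiv_trans f g h : aux_equiv f g -> aux_equiv g h -> aux_equiv f h.
Proof.
by move=> [fg sfg] [gh sgh]; split=> [k k0|]; [rewrite fg ?gh | rewrite sfg].
Qed.

(** Equivalent functions may differ at 0, so the secondary partner of [h] is [p.2] with its entry at
    0 replaced by [h 0]; the maximal tail lies at positive indices and keeps its [N]. *)
Lemma W1_aux_equiv p h : W1 theta p -> primary theta h -> aux_equiv p.1 h ->
  exists2 q, W1 theta q & q.1 = h.
Proof.
move=> [_ [lts [N' [N'0 maxN']]]].
move=> [N [[[N0 maxN] minN] eq_lt eqN eq_gt]] ph [eq_h _].
pose s k := if k is 0 then h 0%N else p.2 k.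
have max_s n : maximal_after theta s n <-> maximal_after theta p.2 n.
  by split=> -[n0 max_n]; split=> // -[|M] // /max_n.
exists (h, s) => //; split=> //=.
  by split=> [[|k] // /lts|]; last by exists N'; apply/max_s; split.
exists N; split=> [|[|k] // lt_kN||k lt_Nk].
- split; first by apply/max_s; split.
  by move=> n /max_s; apply: minN.
- by rewrite -eq_h // eq_lt.
- by rewrite -eq_h // eqN; case: (N) N0.
- by rewrite -eq_h ?eq_gt // (leq_trans _ lt_Nk).
Qed.

Definition F_class p : set (nat -> nat) :=
  [set h | exists q,
    [/\ W1 theta q, aux_equiv q.1 p & h = q.1 \/ h = q.2]]%classic.

Definition G2_class p : set (nat -> nat) :=
  [set h | W2 theta h /\ aux_equiv h p]%classic.

(** Replaces a possibly secondary [h] by a primary member of its class, whose positive digits are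
    determined by the value. *)
Lemma base_set_primary b h V : base_set theta b -> b h -> is_value h V ->
  exists p, [/\ primary theta p, is_value p V, sigma p = sigma h &
    (exists2 q, W1 theta q & q.1 = p) /\ b = F_class p \/
    W2 theta p /\ b = G2_class p].
Proof.
move=> [[p Wp ->] [q [Wq [eqp sp] hq]]|[p Wp ->] [Wh [eqp sp]]] valh.
  have [pp _ _] := Wp; exists p.1.
  split=> //; last by left; split=> //; exists p.
    by apply: eq_is_value eqp _; case: hq valh => ->; rewrite -?W1_value_iff.
  by rewrite -sp; case: hq => ->; rewrite ?W1_sigma.
have [pp _] := Wp; exists p; split=> //; last by right.
exact: eq_is_value valh.
Qed.

Lemma base_set_value b h h' V : base_set theta b -> b h -> b h' ->
  is_value h V -> is_value h' V /\ sigma h' = sigma h.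
Proof.
case=> [[p Wp ->]|[p Wp ->]]; last first.
  move=> [_ eqh] [_ /aux_equiv_sym eqh'] valh.
  have [eqhh' ->] := aux_equiv_trans eqh eqh'; split=> //.
  exact: eq_is_value valh.
move=> [q [Wq eqq hq]] [q' [Wq' /aux_equiv_sym eqq' hq']] valh.
have [eqqq' sq] := aux_equiv_trans eqq eqq'.
have valq' : is_value q'.1 V.
  by apply: eq_is_value eqqq' _; case: hq valh => ->; rewrite -?W1_value_iff.
have sigmaE r f : W1 theta r -> f = r.1 \/ f = r.2 -> sigma f = sigma r.1.
  by move=> /W1_sigma sr [->|->].
split; last by rewrite (sigmaE _ _ Wq hq) (sigmaE _ _ Wq' hq').
by case: hq' => ->; rewrite -?W1_value_iff.
Qed.

Lemma primary_aux_equiv p q V : primary theta p -> primary theta q ->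
  is_value p V -> is_value q V -> sigma p = sigma q -> aux_equiv p q.
Proof.
move=> pp pq valp valq eqs; split=> // k k0.
by rewrite (primary_truncn pp valp) (primary_truncn pq valq); case: k k0.
Qed.

Lemma base_set_uniq b b' h h' V : base_set theta b -> base_set theta b' ->
  b h -> b' h' -> is_value h V -> is_value h' V -> sigma h = sigma h' -> b = b'.
Proof.
move=> Bb Bb' bh bh' valh valh' eqs.
have [p [pp valp sp bE]] := base_set_primary Bb bh valh.
have [p' [pp' valp' sp' bE']] := base_set_primary Bb' bh' valh'.
have eqp : aux_equiv p p'.
  by apply: (primary_aux_equiv pp pp' valp valp'); rewrite sp sp'.
have eq_class q : aux_equiv q.1 p <-> aux_equiv q.1 p'.
  split=> /aux_equiv_trans; apply => //; exact: aux_equiv_sym.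
case: bE bE' => [[[q Wq q1] ->]|[Wp ->]] [[[q' Wq' q1'] ->]|[Wp' ->]].
- by apply/predeqP => f; split=> -[r [Wr /eq_class eqr fr]]; exists r.
(* The mixed cases are contradictory: [W1_aux_equiv] would place a member of [W2] in a pair of
   [W1]. *)
- case: Wp' => _ []; have [|r Wr <-] := W1_aux_equiv Wq pp'.
    by rewrite q1.
  by exists r; split=> //; left.
- case: Wp => _ []; have [|r Wr <-] := W1_aux_equiv Wq' pp.
    by rewrite q1'; apply: aux_equiv_sym.
  by exists r; split=> //; left.
apply/predeqP => f; split=> -[Wf eqf]; split=> //; apply: aux_equiv_trans eqf _.
  by [].
exact: aux_equiv_sym.
Qed.

Lemma base_set_cover h : (forall k, (1 < k)%N -> (h k < theta k.-1)%N) ->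
  exists2 b, base_set theta b & b h.
Proof.
move=> lth.
have [[q [Wq hq]]|noW] := pselect (exists q, W1 theta q /\ (h = q.1 \/ h = q.2)).
  by exists (F_class q.1); [left; exists q | exists q].
have [ph|/secondary_W1[q Wq qh]] := primary_or_secondary lth.
  by exists (G2_class h); [right; exists h | split].
by case: noW; exists q; split=> //; right.
Qed.

(** * Real numbers as classes of equal value and sign *)

Definition value_class (V : K) (s : nat) : set (nat -> nat) :=
  [set f | is_value f V /\ sigma f = s]%classic.

Lemma is_value_base_set f V : is_value f V ->
  exists b h, [/\ base_set theta b, b h, is_value h V, reduces_to f h &
    sigma h = sigma f].
Proof.
move=> valf; have [h red lth] := finite_expansion valf.
have [V' valh] := digits_value_exists lth; have [b Bb bh] := base_set_cover lth.
exists b, h; split; rewrite /sigma ?(reduces_to0 red) //.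
by rewrite (is_value_uniq valf (reduces_to_value red valh)).
Qed.

(** Reduction preserves the value and the entry at 0. Conversely, a function of the right value and
    sign reduces to a member of some base element, which is [b] by uniqueness. *)
Lemma r_E b h V : base_set theta b -> b h -> is_value h V ->
  r_ theta b = value_class V (sigma h).
Proof.
move=> Bb bh valh; apply/predeqP => f; split=> [[h' bh' red]|[valf sf]].
  have [valh' sh'] := base_set_value Bb bh bh' valh.
  split; first exact: reduces_to_value valh'.
  by rewrite -sh' /sigma (reduces_to0 red).
have [b' [h' [Bb' bh' valh' red sh']]] := is_value_base_set valf.
exists h' => //; rewrite (_ : b = b') //.
by apply: base_set_uniq bh bh' valh valh' _; rewrite ?sh' ?sf.
Qed.

(** * The value of a sub-product *)

Local Arguments rest : simpl never.

(** Induction along Horner's scheme: [restS] joins the old floors to the new rest digits, once the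
    old sums are extended by terms that vanish. *)
Lemma scaled_sum_subproduct f g N : (0 < N)%N ->
  scaled_sum (subproduct theta f g) N =
  (\sum_(1 <= n < N.+1) \sum_(1 <= k < N.+1) f n * g k * R theta n k N)%N.
Proof.
elim: N => // -[|N] IHN _; first by rewrite /= muln0.
have -> : scaled_sum (subproduct theta f g) N.+2 =
  (theta N.+1 * scaled_sum (subproduct theta f g) N.+1 +
   \sum_(1 <= n < N.+3) \sum_(1 <= k < N.+3)
     f n * g k * rest theta n k N.+2)%N by [].
rewrite IHN //.
have extend n : (\sum_(1 <= k < N.+2) f n * g k * R theta n k N.+1 =
    \sum_(1 <= k < N.+3) f n * g k * R theta n k N.+1)%N.
  by rewrite [RHS]big_nat_recr //= R_eq0 ?ltnSn ?orbT // muln0 addn0.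
have -> : (\sum_(1 <= n < N.+2) \sum_(1 <= k < N.+2)
      f n * g k * R theta n k N.+1 =
    \sum_(1 <= n < N.+3) \sum_(1 <= k < N.+3)
      f n * g k * R theta n k N.+1)%N.
  rewrite [RHS]big_nat_recr //= [X in (_ + X)%N]big1 ?addn0; last first.
    by move=> k _; rewrite R_eq0 ?ltnSn // muln0.
  by apply: eq_bigr => n _ /=.
rewrite big_distrr -big_split; apply: eq_bigr => n _ /=.
rewrite big_distrr -big_split; apply: eq_bigr => k _ /=.
by rewrite -(restS n k (ltn0Sn N)) mulnDr mulnCA.
Qed.

Lemma subproduct_value f g V W : is_value f V -> is_value g W ->
  is_value (subproduct theta f g) (V * W).
Proof.
move=> valf valg; have [V0 W0] := (is_value_ge0 valf, is_value_ge0 valg).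
have [ubV leV] := valf; have [ubW leW] := valg.
have mulE m : partial_value f m * partial_value g m =
    \sum_(1 <= n < m.+1) \sum_(1 <= k < m.+1)
      (f n * g k)%:R / ((place theta n)%:R * (place theta k)%:R).
  rewrite big_distrlr /=; apply: eq_bigr => n _; apply: eq_bigr => k _.
  by rewrite natrM mulf_div.
have subE m : (0 < m)%N -> partial_value (subproduct theta f g) m =
    \sum_(1 <= n < m.+1) \sum_(1 <= k < m.+1)
      (f n * g k)%:R * ((R theta n k m)%:R / (place theta m)%:R).
  move=> m0; apply: (mulfI (natr_place_neq0 m)); rewrite -natr_scaled_sum //.
  rewrite scaled_sum_subproduct // natr_sum mulr_sumr; apply: eq_bigr => n _.
  rewrite natr_sum mulr_sumr; apply: eq_bigr => k _; rewrite natrM.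
  by field; apply: natr_place_neq0.
have pp n k : 0 < (place theta n)%:R * (place theta k)%:R :> K.
  by rewrite mulr_gt0 ?natr_place_gt0.
(* The upper bound drops the floors in [R]; the lower bound needs a limit, since the floors lose
   something at each level. *)
split=> [m|X leX].
  apply: (@le_trans _ _ (partial_value f m * partial_value g m)); last first.
    by apply: ler_pM; rewrite ?partial_value_ge0.
  case: m => [|m]; first by rewrite !partial_value0 mul0r.
  rewrite subE // mulE; apply: ler_sum => n _; apply: ler_sum => k _.
  rewrite ler_wpM2l // ler_pdivrMr ?natr_place_gt0 // mulrC ler_pdivlMr //.
  by rewrite -!natrM ler_nat R_divn leq_divM.
have diag m : partial_value f m * partial_value g m <= X.
  (* For fixed [m], each floor [R n k N] loses less than one unit [1 / place N]; [c] is the total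
     weight of these losses and does not depend on [N]. *)
  pose c : K := \sum_(1 <= n < m.+1) \sum_(1 <= k < m.+1) (f n * g k)%:R.
  apply: (@le_place_limit _ _ c m.+1) => N lt_mN.
  apply: (@le_trans _ _
    (partial_value (subproduct theta f g) N + c / (place theta N)%:R)); last first.
    by rewrite lerD2r.
  rewrite subE ?(leq_trans _ lt_mN) //.
  apply: (@le_trans _ _ (\sum_(1 <= n < m.+1) \sum_(1 <= k < m.+1)
      (f n * g k)%:R * ((R theta n k N)%:R / (place theta N)%:R) +
      c / (place theta N)%:R)).
    rewrite mulE /c mulr_suml -big_split; apply: ler_sum => n _ /=.
    rewrite mulr_suml -big_split; apply: ler_sum => k _ /=.
    rewrite -mulrDr ler_wpM2l // -{2}[(place theta N)%:R^-1]mul1r -mulrDl natr1.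
    rewrite -[leLHS]mul1r ler_pdivrMr // mulrAC ler_pdivlMr ?natr_place_gt0 //.
    rewrite mul1r.
    by rewrite -!natrM ler_nat R_divn ltnW // ltn_ceil ?muln_gt0 ?place_gt0.
  (* Terms with an index above [m] are nonnegative and are discarded. *)
  rewrite lerD2r [leRHS](big_cat_nat (n := m.+1)) //=; last by rewrite ltnW.
  rewrite -[leLHS]addr0 lerD //; last first.
    apply: sumr_ge0 => n _; apply: sumr_ge0 => k _.
    by rewrite mulr_ge0 ?divr_ge0.
  apply: ler_sum => n _; rewrite [leRHS](big_cat_nat (n := m.+1)) //=; last first.
    by rewrite ltnW.
  by rewrite lerDl; apply: sumr_ge0 => k _; rewrite mulr_ge0 ?divr_ge0.
have cross n m : partial_value f n * partial_value g m <= X.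
  apply: le_trans (diag (maxn n m)); apply: ler_pM;
    by rewrite ?partial_value_ge0 ?le_partial_value ?leq_maxl ?leq_maxr.
(* The two suprema are taken one after the other, by dividing by the other factor; a zero factor is
   treated apart. *)
have half n : partial_value f n * W <= X.
  have := partial_value_ge0 f n; rewrite le_eqVlt => /orP[/eqP pf|pf].
    by rewrite -pf mul0r; have := cross 0%N 0%N; rewrite partial_value0 mul0r.
  rewrite mulrC -ler_pdivlMr //; apply: leW => m.
  by rewrite ler_pdivlMr // mulrC.
move: W0; rewrite le_eqVlt => /orP[/eqP W0|W0].
  by move: (half 0%N); rewrite -W0 !mulr0.
by rewrite -ler_pdivlMr //; apply: leV => n; rewrite ler_pdivlMr.
Qed.

(** * Zero, one and the inverse *)

Lemma zero_value f : (forall k, (0 < k)%N -> f k = 0%N) -> is_value f 0.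
Proof.
move=> f0; have pv n : partial_value f n = 0.
  by rewrite /partial_value big_nat big1 // => k /andP[/f0-> _]; rewrite mul0r.
by split=> [n|W /(_ 0%N)]; rewrite pv.
Qed.

Lemma one_value : is_value one_p 1.
Proof.
have pv n : partial_value one_p n.+1 = 1.
  rewrite /partial_value big_ltn // place1 divr1 big_nat big1 ?addr0 //.
  by move=> [|[|k]] // _; rewrite mul0r.
split=> [n|W /(_ 1%N)]; last by rewrite pv.
by rewrite -(pv n) le_partial_value.
Qed.

(** A base element containing [h] exists, so [xget] does not return its default [set0]. *)
Lemma xget_base_set h : (forall k, (1 < k)%N -> (h k < theta k.-1)%N) ->
  let b := xget set0 [set b | base_set theta b /\ b h]%classic in
  base_set theta b /\ b h.
Proof.
move=> /base_set_cover[b0 Bb0 b0h] b.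
suff: [set b | base_set theta b /\ b h]%classic b by [].
by apply: xgetPex; exists b0.
Qed.

Lemma base_set_b1 : base_set theta (b1 theta) /\ b1 theta (fun _ => 0%N).
Proof. by apply: xget_base_set => -[|[|k]] // _; apply: theta_gt0. Qed.

Lemma base_set_b2 : base_set theta (b2 theta) /\
  b2 theta (fun k => if k == 0%N then 1%N else 0%N).
Proof. by apply: xget_base_set => -[|[|k]] // _; apply: theta_gt0. Qed.

(** [b1] has even and [b2] odd entry at 0, so their union imposes no sign. *)
Lemma zeroRE f : zeroR theta f <-> is_value f 0.
Proof.
have [[B1 b10] [B2 b20]] := (base_set_b1, base_set_b2).
have val1 : is_value (fun _ => 0%N) 0 by apply: zero_value.
have val2 : is_value (fun k => if k == 0%N then 1%N else 0%N) 0.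
  by apply: zero_value => -[].
rewrite /zeroR (r_E B1 b10 val1) (r_E B2 b20 val2) /sigma /=.
split=> [[[]//|[]//]|valf]; rewrite /setU /= /value_class /= /sigma.
by case: (odd (f 0%N)); [right | left].
Qed.

Lemma base_set_value0 b h : base_set theta b -> b h -> is_value h 0 ->
  b = b1 theta \/ b = b2 theta.
Proof.
move=> Bb bh valh; have [[B1 b10] [B2 b20]] := (base_set_b1, base_set_b2).
case: (boolP (odd (h 0%N))) => h0; [right|left].
  apply: (base_set_uniq Bb B2 bh b20 valh); last by rewrite /sigma h0.
  by apply: zero_value => -[].
apply: (base_set_uniq Bb B1 bh b10 valh); last by rewrite /sigma (negbTE h0).
exact: zero_value.
Qed.

(** All members of a base element share one value, so a positive value rules out [b1] and [b2]. *)
Lemma SR_value_class f V : 0 < V -> is_value f V ->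
  SR theta (value_class V (sigma f)).
Proof.
move=> V0 valf; have [b [h [Bb bh valh _ <-]]] := is_value_base_set valf; left.
exists b; split=> // [eqb|eqb|]; last by rewrite (r_E Bb bh valh).
  have [_ b10] := base_set_b1; rewrite -eqb in b10.
  have [val0 _] := base_set_value Bb bh b10 valh.
  have /is_value_uniq /(_ val0) eqV : is_value (fun _ => 0%N) 0 by apply: zero_value.
  by rewrite -eqV ltxx in V0.
have [_ b20] := base_set_b2; rewrite -eqb in b20.
have [val0 _] := base_set_value Bb bh b20 valh.
have /is_value_uniq /(_ val0) eqV :
  is_value (fun k => if k == 0%N then 1%N else 0%N) 0 by apply: zero_value => -[].
by rewrite -eqV ltxx in V0.
Qed.

Lemma base_set_nonempty b : base_set theta b ->
  exists2 h, b h & exists V, is_value h V.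
Proof.
case=> [[q Wq ->]|[h Wh ->]].
  have [[lt1 _] _ _] := Wq; exists q.1; last exact: digits_value_exists.
  by exists q; split=> //; left.
by have [[lth _] _] := Wh; exists h; [split | exact: digits_value_exists].
Qed.

Lemma SR_value x : SR theta x -> x <> zeroR theta ->
  exists f V, [/\ 0 < V, is_value f V & x = value_class V (sigma f)].
Proof.
move=> [[b [Bb neb1 neb2 ->]] _|//].
have [h bh [V valh]] := base_set_nonempty Bb; exists h, V.
split=> //; last exact: r_E.
rewrite lt_neqAle (is_value_ge0 valh) andbT; apply/eqP => V0; rewrite -V0 in valh.
by have [] := base_set_value0 Bb bh valh.
Qed.

Lemma real_of_value f V : 0 < V -> is_value f V ->
  real_of theta f = value_class V (sigma f).
Proof.
move=> V0 valf; apply: xget_unique => [|x [SRx xf]].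
  by split=> //; apply: SR_value_class.
have [x0|/(SR_value SRx)[g [W [_ _ xE]]]] := pselect (x = zeroR theta).
  move: xf; rewrite x0 zeroRE => val0.
  by rewrite (is_value_uniq valf val0) ltxx in V0.
by move: xf; rewrite xE => -[/(is_value_uniq valf)-> ->].
Qed.

(** Entries at 0 of equal parity have an even sum, which gives the sign of [one_p]; hence the
    inverse must carry the same sign as the given number. *)
Lemma sigma_subproduct f g : sigma f = sigma g ->
  sigma (subproduct theta f g) = 1%N.
Proof. by rewrite /sigma /subproduct /= oddD; case: odd; case: odd. Qed.

Lemma mulR_invertible x : SR theta x -> x <> zeroR theta ->
  exists y, SR theta y /\ mulR theta x y = oneR theta.
Proof.
move=> SRx /(SR_value SRx)[f [V [V0 valf ->]]].
(* The entry [f 0] gives [g] the sign of [f]. *)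
pose g := digits (f 0%N) (fun n => Num.truncn ((place theta n)%:R * V^-1)).
have valg : is_value g V^-1 by apply: is_value_digits; rewrite invr_ge0 ltW.
have W0 : 0 < V^-1 by rewrite invr_gt0.
have prod f' g' : value_class V (sigma f) f' -> value_class V^-1 (sigma g) g' ->
    real_of theta (subproduct theta f' g') = oneR theta.
  move=> [valf' sf'] [valg' sg'].
  have := subproduct_value valf' valg'; rewrite divff ?gt_eqF // => val1.
  rewrite /oneR (real_of_value ltr01 one_value) (real_of_value ltr01 val1).
  by rewrite sigma_subproduct // sf' sg'.
exists (value_class V^-1 (sigma g)); split; first exact: SR_value_class.
(* Both classes are inhabited, by [f] and [g], so the condition defining the product determines
   [z]. *)
apply: xget_unique => [|z [_ /(_ f g)<-//]].
  split; last by move=> f' g' xf yg; apply: prod.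
  rewrite /oneR (real_of_value ltr01 one_value).
  exact: SR_value_class ltr01 one_value.
exact: prod.
Qed.

End RadixExpansions.

Theorem mainTheorem15 (theta : nat -> nat) (htheta : system_function theta)
    (a : set (nat -> nat)) (ha : SR theta a) (ha0 : a <> zeroR theta) :
  exists xi : set (nat -> nat), SR theta xi /\ mulR theta a xi = oneR theta.
(* The statement mentions no ordered field; the reals of Rocq serve as the [realType] in which
   values are measured. *)
Proof. exact: (mulR_invertible Rdefinitions.R htheta ha ha0). Qed.
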